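(* Let $N\ge2$, let $F(\cdot,t):\mathbb{R}^n\times\mathbb{R}^n\rightrightarrows\mathbb{R}^n$ ($t=0,\dots,N-2$) be convex closed set-valued mappings, $Q_0,Q_1\subseteq\mathbb{R}^n$ nonempty convex closed sets, and $\varphi:\mathbb{R}^{2n}\to\mathbb{R}\cup\{+\infty\}$ a proper convex closed function. Consider the primary problem $(P_D)$: minimize $\varphi(x_{N-1},x_N)$ subject to $x_{t+2}\in F(x_t,x_{t+1},t)$, $t=0,\dots,N-2$, $x_0\in Q_0$, $x_1\in Q_1$; and its dual problem $$(P_D^* )\quad \sup_{\substack{x_t^*,\,x_N^*,\,\mu_t^*\\ t=0,\dots,N-1}}\Big\{-\varphi^*(\mu_{N-1}^*-x_{N-1}^*,-x_N^* )+\sum_{t=0}^{N-2}M_{F(\cdot,t)}(x_t^*-\mu_t^*,\mu_{t+1}^*,x_{t+2}^* )-W_{Q_0}(x_0^*-\mu_0^* )-W_{Q_1}(x_1^* )\Big\}.$$ Suppose that $\{\tilde x_t\}_{t=0}^N$ is an optimal solution of $(P_D)$ and that the nondegeneracy condition is satisfied. Then a family of vectors $x_t^*$ ($t=0,\dots,N$), $\mu_t^*$ ($t=0,\dots,N-1$) is an optimal solution to the dual problem $(P_D^* )$ if and only if the following conditions are satisfied: (i) $(x_t^*-\mu_t^*,\ \mu_{t+1}^* )\in F^*\big(x_{t+2}^*;(\tilde x_t,\tilde x_{t+1},\tilde x_{t+2}),t\big)$, $t=0,1,\dots,N-2$; (ii) $\mu_0^*-x_0^*\in K_{Q_0}^*(\tilde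 x_0)$ and $-x_1^*\in K_{Q_1}^*(\tilde x_1)$; (iii) $(\mu_{N-1}^*-x_{N-1}^*,\ -x_N^* )\in\partial_{(x,y)}\varphi(\tilde x_{N-1},\tilde x_N)$.
   Context: A set-valued mapping $G:\mathbb{R}^{2n}\rightrightarrows\mathbb{R}^n$ is convex closed if $\mathrm{gph}\,G=\{(x,y,z): z\in G(x,y)\}$ is a convex closed set in $\mathbb{R}^{3n}$. A function is closed if its epigraph is closed. Notation: - $\varphi^*(x^*,y^* )=\sup_{x,y}\{\langle x,x^*\rangle+\langle y,y^*\rangle-\varphi(x,y)\}$; - $M_G(x^*,y^*,z^* )=\inf\{\langle x,x^*\rangle+\langle y,y^*\rangle-\langle z,z^*\rangle:(x,y,z)\in\mathrm{gph}\,G\}$; - $W_A(x^* )=\sup_{x\in A}\langle x,x^*\rangle$; - for a convex set $A$ and $w_0\in A$, $K_A(w_0)$ is the convex cone of tangent directions, i.e. of vectors $\bar w$ for which there is a function $\eta$ with $w_0+\lambda\bar w+\eta(\lambda)\in A$ for all sufficiently small $\lambda>0$ and $\lambda^{-1}\eta(\lambda)\to0$ as $\lambda\downarrow0$; $K_A^*(w_0)=\{w^*:\langle\bar w,w^*\rangle\ge0\ \forall\bar w\in K_A(w_0)\}$ (for convex $A$ this equals $\{w^*:\langle w-w_0,w^*\rangle\ge 0\ \forall w\in A\}$); - locally adjoint mapping: $G^*(z^*;(x,y,z))=\{(x^*,y^* ):(x^*,y^*,-z^* )\in K^*_{\mathrm{gph}\,G}(x,y,z)\}$; $F^*(\cdot\,;\cdot,t)$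 is that of $F(\cdot,t)$; - $\partial_{(x,y)}\varphi$ is the subdifferential of convex analysis. Nondegeneracy condition: there are points $x_t\in\mathbb{R}^n$, $t=0,\dots,N$, such that one of the following holds: (1) $(x_t,x_{t+1},x_{t+2})\in\mathrm{ri}\,\mathrm{gph}\,F(\cdot,t)$, $t=0,\dots,N-2$, $x_0\in\mathrm{ri}\,Q_0$, $x_1\in\mathrm{ri}\,Q_1$, $(x_{N-1},x_N)\in\mathrm{ri}\,\mathrm{dom}\,\varphi$; (2) $(x_t,x_{t+1},x_{t+2})\in\mathrm{int}\,\mathrm{gph}\,F(\cdot,t)$, $t=0,\dots,N-2$, $x_0\in\mathrm{int}\,Q_0$, $x_1\in\mathrm{int}\,Q_1$ (with the possible exception of one fixed $t$, for which only membership in the set itself is required), and $\varphi$ is continuous at $(x_{N-1},x_N)$. Here $\mathrm{ri}$ denotes relative interior, $\mathrm{int}$ interior and $\mathrm{dom}\,\varphi=\{\varphi<+\infty\}$. *)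

(* Defs.v *)
From HB Require Import structures.
From mathcomp Require Import all_boot all_order all_algebra.
From mathcomp Require Import all_classical all_reals all_analysis.

Set Implicit Arguments.
Unset Strict Implicit.
Unset Printing Implicit Defensive.

Import Order.TTheory GRing.Theory Num.Theory.
Import numFieldNormedType.Exports.

Local Open Scope classical_set_scope.
Local Open Scope ring_scope.

(* R^n is 'rV[R]_n, while R^(2n) and R^(3n) are iterated products of it.  The
   library topology (sup norm) on these spaces is the Euclidean one. *)

Section inner_products.
Context {R : realType} {n : nat}.
Local Notation V := 'rV[R]_n.

Definition dot (x y : V) : R := \sum_(i < n) x 0 i * y 0 i.

Definition dot2 (p q : V * V) : R := dot p.1 q.1 + dot p.2 q.2.

Definition dot3 (w v : V * V * V) : R := dot2 w.1 v.1 + dot w.2 v.2.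

End inner_products.

Section convex_sets.
Context {R : realType} {W : normedModType R}.
Implicit Types (A : set W) (w : W).

Definition convex_closed A : Prop := @convex_set R W A /\ closed A.

Definition affine_set A : Prop :=
  forall x y (l : R), A x -> A y -> A (l *: x + (1 - l) *: y).

Definition affine_hull A : set W := smallest affine_set A.

Definition relint A : set W :=
  [set x | A x /\ \forall y \near x, affine_hull A y -> A y].

Definition tangent_cone A w : set W :=
  [set v | exists eta : R -> W,
     (l^-1 *: eta l @[l --> 0^'+] --> (0 : W)) /\
     (\forall l \near 0^'+, A (w + l *: v + eta l))].

Definition dual_tangent_cone (ip : W -> W -> R) A w : set W :=
  [set ws | forall v, tangent_cone A w v -> 0 <= ip v ws].

End convex_sets.

Section set_valued_maps.
Context {R : realType} {n : nat}.
Local Notation V := 'rV[R]_n.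
Implicit Types (G : V -> V -> set V) (A : set V).

Definition gph G : set (V * V * V) := [set w | G w.1.1 w.1.2 w.2].

Definition adj_inf G (xs ys zs : V) : \bar R :=
  ereal_inf
    [set (dot w.1.1 xs + dot w.1.2 ys - dot w.2 zs)%:E | w in gph G].

Definition support_fun A (xs : V) : \bar R :=
  ereal_sup [set (dot x xs)%:E | x in A].

Definition locally_adjoint G (zs : V) (w : V * V * V) : set (V * V) :=
  [set p | dual_tangent_cone dot3 (gph G) w (p.1, p.2, - zs)].

End set_valued_maps.

Section convex_functions.
Context {R : realType} {n : nat}.
Local Notation V := 'rV[R]_n.
Implicit Types phi : V * V -> \bar R.
Local Open Scope ereal_scope.

Definition epigraph phi : set (V * V * R^o) :=
  [set q | phi q.1 <= (q.2 : R)%:E].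

Definition edom phi : set (V * V) := [set p | phi p < +oo].

(* [phi] takes its values in R U {+oo} and is not identically +oo *)
Definition proper_efun phi : Prop := (forall p, phi p != -oo) /\ edom phi !=set0.

Definition conjugate phi (ps : V * V) : \bar R :=
  ereal_sup [set (dot2 p ps)%:E - phi p | p in setT].

Definition subdifferential phi (p0 : V * V) : set (V * V) :=
  [set ps | forall p, phi p0 + (dot2 (p - p0)%R ps)%:E <= phi p].

(* Finiteness is explicit because a function that is constantly +oo around [p]
   would be continuous at [p] for the topology of \bar R. *)
Definition continuous_pt phi (p : V * V) : Prop :=
  phi p \is a fin_num /\ phi q @[q --> p] --> phi p.

End convex_functions.

(* Families indexed by 0, ..., N (resp. 0, ..., N - 1, 0, ..., N - 2) are
   functions on nat of which only these values are ever used. *)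
Section problem.
Context {R : realType} {n : nat}.
Local Notation V := 'rV[R]_n.
Variables (N : nat) (F : nat -> V -> V -> set V) (Q0 Q1 : set V).
Variable phi : V * V -> \bar R.
Implicit Types x xs mus : nat -> V.

Definition feasible x : Prop :=
  [/\ forall t, (t.+2 <= N)%N -> F t (x t) (x t.+1) (x t.+2),
      Q0 (x 0%N) & Q1 (x 1%N)].

Definition primal_objective x : \bar R := phi (x N.-1, x N).

Definition primal_optimal x : Prop :=
  feasible x /\
  forall y, feasible y -> (primal_objective x <= primal_objective y)%E.

Definition dual_objective xs mus : \bar R :=
  (- conjugate phi (mus N.-1 - xs N.-1, - xs N)%R
   + \sum_(0 <= t < N.-1) adj_inf (F t) (xs t - mus t)%R (mus t.+1) (xs t.+2)
   - support_fun Q0 (xs 0%N - mus 0%N)%R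
   - support_fun Q1 (xs 1%N))%E.

Definition dual_value : \bar R :=
  ereal_sup [set d | exists xs mus, d = dual_objective xs mus].

Definition dual_optimal xs mus : Prop := dual_objective xs mus = dual_value.

Definition nondegenerate_ri x : Prop :=
  [/\ forall t, (t.+2 <= N)%N ->
        relint (gph (F t)) (x t, x t.+1, x t.+2),
      relint Q0 (x 0%N),
      relint Q1 (x 1%N) &
      relint (edom phi) (x N.-1, x N)].

(* [s] is the possible exceptional time, at which only membership is asked *)
Definition nondegenerate_int x : Prop :=
  [/\ exists s, forall t, (t.+2 <= N)%N ->
        gph (F t) (x t, x t.+1, x t.+2) /\
        (t != s -> interior (gph (F t)) (x t, x t.+1, x t.+2)),
      interior Q0 (x 0%N),
      interior Q1 (x 1%N) &
      continuous_pt phi (x N.-1, x N)].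

Definition nondegeneracy : Prop :=
  exists x, nondegenerate_ri x \/ nondegenerate_int x.

End problem.

(* Main.v *)
Require Import Defs.
From mathcomp Require Import all_boot all_order all_algebra.
From mathcomp Require Import all_classical all_reals all_analysis.
From mathcomp Require Import ring lra zify.

(** The dual problem is the Lagrangian dual of a decoupled copy of the primal
    one, and the theorem is the saddle-point characterization of its solutions.

    Decoupling.  Let every graph [gph (F t)], the sets [Q0] and [Q1], and the
    function [phi] choose their own points: triples [y t], points [q0] and
    [q1], and a pair [p].  Such a choice comes from one trajectory exactly when
    the different copies of each state coincide.  The state at time [t] occurs
    up to three times: as the first entry of [y t] (or as an entry of [p] when
    [t >= N - 1]), as the middle entry of [y t.-1], and as the last entry of
    [y t.-2], with [q0] and [q1] filling in at times 0 and 1.  Attach the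
    multiplier [xs t] to (first copy - last copy) and [mus t] to
    (middle copy - first copy).  Collecting the terms of this Lagrangian block
    by block ([lagrangianE]) gives one expression for each graph, for [Q0], for
    [Q1] and for [phi]; minimizing them separately turns them into the terms
    M_F, W_Q0, W_Q1 and the conjugate of [phi].  So [dual_objective xs mus] is
    the infimum of the Lagrangian over all decoupled choices
    ([dual_objective_le], [dual_objective_ge]), and weak duality is the remark
    that the Lagrangian of a genuine trajectory is its cost.

    Strong duality.  Multipliers that bring the infimum up to the primal optimal
    value exist by an alternative theorem for finitely many affine equality
    constraints ([multipliers_seq]).  Its constraint qualification is that every
    admissible deviation from the constraints can be countered by a small
    multiple of the opposite deviation.  The nondegeneracy condition gives this
    ([nondegenerate_ri_slater], [nondegenerate_int_slater]): from a
    nondegenerate trajectory, move a little in the direction that points away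
    from the given choice.

    Conclusion.  Since the dual value equals the optimal cost, [(xs, mus)] is
    dual optimal iff the optimal trajectory minimizes the Lagrangian
    [lagrangian xs mus] over the decoupled choices.  The blocks being
    independent, this means that each block term is minimal at the optimal
    trajectory ([lagrangian_minP]).  For a convex set, minimality of a linear
    form at a point says that the form belongs to the dual tangent cone there
    ([dual_tangent_coneE]), which gives (i) and (ii); for [phi] it is the
    subgradient inequality (iii) ([stationaryP]). *)

Import Order.TTheory GRing.Theory Num.Theory.
Import numFieldNormedType.Exports.

Set Implicit Arguments.
Unset Strict Implicit.
Unset Printing Implicit Defensive.

Local Open Scope classical_set_scope.
Local Open Scope ring_scope.

(** * Multipliers for convex programs with equality constraints *)

Section multipliers.
Context {R : realType} {E : Type}.
Implicit Types (S : set E) (h rho : E -> R).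

(** The attainable pairs [(h a, rho a)] leave room for a line through
    [(0, alpha)] below them.  Its slope has to lie between the slopes forced by
    the points with [h a > 0] and those forced by the points with [h b < 0], and
    convexity makes these compatible: a combination of [a] and [b] on which [h]
    vanishes has cost at least [alpha].  The opposite deviations ensure that
    both kinds of points occur together, so that the supremum of the lower
    bounds is finite. *)
Lemma multiplier1 S h rho (alpha : R) :
    (forall a b l, S a -> S b -> 0 < l < 1 -> exists c,
       [/\ S c, h c = l * h a + (1 - l) * h b &
                rho c <= l * rho a + (1 - l) * rho b]) ->
    (forall a, S a -> exists c, exists2 e, 0 < e & S c /\ h c = - (e * h a)) ->
    (forall a, S a -> h a = 0 -> alpha <= rho a) ->
  exists k, forall a, S a -> alpha <= rho a + k * h a.
Proof.
move=> cvx sym opt.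
have [[a0 [Sa0 ha0]]|nopos] := pselect (exists a, S a /\ 0 < h a); last first.
  exists 0 => a Sa; rewrite mul0r addr0; apply: opt => //.
  have le0 b : S b -> h b <= 0.
    by move=> Sb; rewrite leNgt; apply/negP => hb; apply: nopos; exists b.
  apply/eqP; rewrite eq_le le0 //=.
  have [c [e e0 [Sc hc]]] := sym _ Sa; have := le0 _ Sc.
  by rewrite hc oppr_le0 pmulr_rge0.
(* This is [alpha <= rho c] at the combination of [a] and [b] with [h c = 0]. *)
have cross a b : S a -> S b -> 0 < h a -> h b < 0 ->
    (alpha - rho a) / h a <= (rho b - alpha) / - h b.
  move=> Sa Sb ha hb.
  have hab : 0 < h a - h b by lra.
  have [|c [Sc hc rc]] := cvx a b (- h b / (h a - h b)) Sa Sb.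
    by rewrite divr_gt0 ?oppr_gt0 //= ltr_pdivrMr // mul1r; lra.
  have {}hc : h c = 0 by rewrite hc; field; lra.
  have := le_trans (opt _ Sc hc) rc.
  have -> : - h b / (h a - h b) * rho a + (1 - - h b / (h a - h b)) * rho b =
      (h a * rho b - h b * rho a) / (h a - h b) by field; lra.
  rewrite ler_pdivlMr // => le_ab.
  by rewrite ler_pdivrMr // mulrAC ler_pdivlMr ?oppr_gt0 //; lra.
pose A := [set (alpha - rho a) / h a | a in [set a | S a /\ 0 < h a]].
have [b0 [e e0 [Sb0 hb0]]] := sym _ Sa0.
have {e e0} hb0 : h b0 < 0 by rewrite hb0 oppr_lt0 mulr_gt0.
have ubA b : S b -> h b < 0 -> ubound A ((rho b - alpha) / - h b).
  by move=> Sb hb _ [a [Sa ha] <-]; exact: cross.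
have supA : has_sup A.
  by split; [exists ((alpha - rho a0) / h a0); exists a0
            |exists ((rho b0 - alpha) / - h b0); exact: ubA].
exists (sup A) => a Sa; rewrite -lerBlDl.
have [ha|ha|ha] := ltgtP (h a) 0; last by rewrite ha mulr0 subr_le0 opt.
- have : sup A <= (rho a - alpha) / - h a.
    by apply: ge_sup; [exact: (proj1 supA)|exact: ubA].
  by rewrite ler_pdivlMr ?oppr_gt0 //; lra.
- have : (alpha - rho a) / h a <= sup A.
    by apply: ub_le_sup; [exact: (proj2 supA)|exists a].
  by rewrite ler_pdivrMr.
Qed.

(** A Lagrange multiplier theorem for the constraints [g i = 0], [i \in s],
    obtained by dualizing them one at a time: the induction hypothesis is
    applied to the points that satisfy the first constraint, and [multiplier1]
    then relaxes that constraint, with the partial Lagrangian as the cost.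
    Convexity is expressed through the values of [g] and [rho], which lets [E]
    be any type and makes the hypothesis stable under this restriction. *)
Lemma multipliers_seq (I : eqType) (s : seq I) (g : I -> E -> R) S rho alpha :
    uniq s ->
    (forall a b l, S a -> S b -> 0 < l < 1 -> exists c,
       [/\ S c, forall i, g i c = l * g i a + (1 - l) * g i b &
                rho c <= l * rho a + (1 - l) * rho b]) ->
    (forall a, S a -> exists c, exists2 e, 0 < e &
       S c /\ forall i, g i c = - (e * g i a)) ->
    (forall a, S a -> {in s, forall i, g i a = 0} -> alpha <= rho a) ->
  exists k : I -> R,
    forall a, S a -> alpha <= rho a + \sum_(i <- s) k i * g i a.
Proof.
elim: s S => [|i s IHs] S.
  by move=> _ _ _ opt; exists (fun=> 0) => a Sa; rewrite big_nil addr0 opt.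
move=> /= /andP[si us] cvx sym opt.
have [|||k kP] := IHs (S `&` [set a | g i a = 0]) us.
- move=> a b l [Sa ga] [Sb gb] l01.
  have [c [Sc gc rc]] := cvx _ _ _ Sa Sb l01.
  by exists c; split=> //; split=> //=; rewrite gc ga gb !mulr0 addr0.
- move=> a [Sa ga]; have [c [e e0 [Sc gc]]] := sym _ Sa.
  exists c; exists e => //; split=> //; split=> //=.
  by rewrite gc ga mulr0 oppr0.
- move=> a [Sa ga] gs; apply: opt => // j.
  by rewrite inE => /predU1P[->//|]; exact: gs.
have [|||ki kiP] := @multiplier1 S (g i)
    (fun a => rho a + \sum_(j <- s) k j * g j a) alpha.
- move=> a b l Sa Sb l01; have [c [Sc gc rc]] := cvx _ _ _ Sa Sb l01.
  exists c; split=> //.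
  under eq_bigr do rewrite gc mulrDr (mulrCA (k _)) (mulrCA (k _)).
  by rewrite big_split -!mulr_sumr /=; lra.
- move=> a Sa; have [c [e e0 [Sc gc]]] := sym _ Sa.
  by exists c; exists e.
- by move=> a Sa ga; apply: kP.
exists (fun j => if j == i then ki else k j) => a Sa.
rewrite big_cons eqxx addrCA addrA [X in X + _]addrC -addrA.
rewrite [X in _ + X]addrC addrA.
suff -> : \sum_(j <- s) (if j == i then ki else k j) * g j a =
          \sum_(j <- s) k j * g j a by exact: kiP.
apply: eq_big_seq => j js; case: eqP => // ji.
by rewrite -ji js in si.
Qed.

End multipliers.

(** * Convex sets, rays and dual tangent cones *)

Section convex_sets.
Context {R : realType} {W : normedModType R}.
Implicit Types (A : set W) (w x y v : W).

Lemma convex_comb A x y (l : R) : @convex_set R W A -> A x -> A y ->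
  0 < l < 1 -> A (l *: x + (1 - l) *: y).
Proof.
move=> /convex_setW cA Ax Ay /andP[l0 l1].
have i01 : 0 <= l <= 1 by rewrite !ltW.
have := cA x y (mem_set Ax) (mem_set Ay) (Itv01 (ltW l0) (ltW l1)) l0 l1.
by rewrite inE.
Qed.

Lemma cvg_ray w v : w + l *: v @[l --> 0^'+] --> w.
Proof.
have : w + l *: v @[l --> (0 : R)^'+] --> w + 0 *: v.
  apply: cvg_at_right_filter; apply: cvgD; first exact: cvg_cst.
  by apply: cvgZr_tmp; exact: cvg_id.
by rewrite scale0r addr0.
Qed.

Lemma interior_ray A w v : interior A w -> \forall l \near 0^'+, A (w + l *: v).
Proof. exact: cvg_ray. Qed.

(** A segment that joins a point of [A] to a relative interior point can be
    prolonged beyond the latter, as the extension stays in the affine hull. *)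
Lemma relint_ray A w y : relint A w -> A y ->
  \forall l \near 0^'+, A (w + l *: (w - y)).
Proof.
move=> [Aw riA] Ay; near=> l.
have : affine_hull A (w + l *: (w - y)) -> A (w + l *: (w - y)).
  by near: l; exact: cvg_ray riA.
apply=> B [affB AB].
have -> : w + l *: (w - y) = (1 + l) *: w + (1 - (1 + l)) *: y.
  by rewrite opprD addNKr scaleNr scalerDl scale1r scalerBr addrA.
by apply: affB; exact: AB.
Unshelve. all: by end_near. Qed.

(** By convexity each [x - w] with [A x] is a tangent direction, with zero
    correction term; conversely, tangent directions are limits of positive
    multiples of such vectors, and the sign of [ip] passes to the limit. *)
Lemma dual_tangent_coneE (ip : W -> W -> R) A w :
    (forall ws, linear_for *%R (ip^~ ws)) ->
    (forall ws, continuous (ip^~ ws)) ->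
    @convex_set R W A -> A w ->
  dual_tangent_cone ip A w = [set ws | forall x, A x -> ip w ws <= ip x ws].
Proof.
move=> ip_lin ip_cont cA Aw; apply/seteqP; split=> ws /= H.
- move=> x Ax.
  have ipB : ip (x - w) ws = ip x ws - ip w ws.
    by rewrite -[x - w]addrC -[- w]scaleN1r ip_lin mulN1r addrC.
  rewrite -subr_ge0 -ipB; apply: H; exists (fun=> 0); split.
    by under eq_cvg do rewrite scaler0; exact: cvg_cst.
  near=> l; rewrite addr0.
  have -> : w + l *: (x - w) = l *: x + (1 - l) *: w.
    by rewrite scalerBl scale1r scalerBr addrCA.
  apply: convex_comb => //; apply/andP; split; near: l.
    exact: nbhs_right_gt.
  by apply: nbhs_right_lt; exact: ltr01.
- move=> v [eta [eta0 Aeta]].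
  have ip_lim : ip (l^-1 *: eta l + v) ws @[l --> 0^'+] --> ip v ws.
    have cvg_v : l^-1 *: eta l + v @[l --> 0^'+] --> v.
      have := cvgD eta0 (cvg_cst v); rewrite add0r; exact.
    exact: (cvg_comp _ _ cvg_v (ip_cont ws v)).
  apply: cvgr_to_ge ip_lim _.
  near=> l.
  have l0 : 0 < l by near: l; exact: nbhs_right_gt.
  rewrite -(pmulr_rge0 _ l0).
  have := H (w + l *: v + eta l); have /[swap]/[apply] : A (w + l *: v + eta l).
    by near: l.
  have -> : w + l *: v + eta l = l *: (l^-1 *: eta l + v) + w.
    rewrite scalerDr scalerA divff ?gt_eqF // scale1r.
    by rewrite [RHS]addrC [eta _ + _]addrC addrA.
  by rewrite ip_lin lerDr.
Unshelve. all: by end_near. Qed.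

End convex_sets.

Section inner_products.
Context {R : realType} {n : nat}.
Local Notation V := 'rV[R]_n.
Implicit Types x y z : V.

Lemma dot_linear (z : V) : linear_for *%R (dot^~ z).
Proof.
move=> a x y; rewrite /dot mulr_sumr -big_split; apply: eq_bigr => i _.
by rewrite !mxE mulrDl mulrA.
Qed.

Lemma dotDl x y z : dot (x + y) z = dot x z + dot y z.
Proof. by rewrite -[x]scale1r dot_linear mul1r scale1r. Qed.

Lemma dotZl a x z : dot (a *: x) z = a * dot x z.
Proof. by rewrite /dot mulr_sumr; apply: eq_bigr => i _; rewrite mxE mulrA. Qed.

Lemma dotNl x z : dot (- x) z = - dot x z.
Proof. by rewrite -scaleN1r dotZl mulN1r. Qed.

Lemma dot0l z : dot 0 z = 0.
Proof. by rewrite -(scale0r 0) dotZl mul0r. Qed.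

Lemma dotBl x y z : dot (x - y) z = dot x z - dot y z.
Proof. by rewrite dotDl dotNl. Qed.

Lemma dotC x y : dot x y = dot y x.
Proof. by apply: eq_bigr => i _; rewrite mulrC. Qed.

Lemma dotNr x z : dot x (- z) = - dot x z.
Proof. by rewrite dotC dotNl dotC. Qed.

Lemma dotBr x y z : dot x (y - z) = dot x y - dot x z.
Proof. by rewrite dotC dotBl !(dotC _ x). Qed.

Lemma dot2Bl (p q v : V * V) : dot2 (p - q) v = dot2 p v - dot2 q v.
Proof. by rewrite /dot2 /= !dotBl; ring. Qed.

Lemma dot3_linear (v : V * V * V) : linear_for *%R (dot3^~ v).
Proof. by move=> a x y; rewrite /dot3 /dot2 /= !dot_linear; ring. Qed.

Lemma dot_continuous z : continuous (dot^~ z).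
Proof.
apply: continuous_big => [|i _]; first exact: add_continuous.
move=> x; have x_i : (y : V) 0 i @[y --> x] --> x 0 i.
  exact: coord_continuous.
by have := cvgM x_i (cvg_cst (z 0 i)); exact.
Qed.

Lemma dot3_continuous (v : V * V * V) : continuous (dot3^~ v).
Proof.
move=> [[x y] z].
have cvg1 : w.1 @[w --> (x, y, z)] --> (x, y) by exact: cvg_fst.
have cvg11 : w.1.1 @[w --> (x, y, z)] --> x.
  by apply: (cvg_comp _ _ cvg1); exact: cvg_fst.
have cvg12 : w.1.2 @[w --> (x, y, z)] --> y.
  by apply: (cvg_comp _ _ cvg1); exact: cvg_snd.
have cvg2 : w.2 @[w --> (x, y, z)] --> z by exact: cvg_snd.
have := cvgD (cvgD (cvg_comp _ _ cvg11 (@dot_continuous v.1.1 x))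
                   (cvg_comp _ _ cvg12 (@dot_continuous v.1.2 y)))
             (cvg_comp _ _ cvg2 (@dot_continuous v.2 z)).
exact.
Qed.

End inner_products.

(** * Infima of separable sums *)

Section extended_sums.
Context {R : realType} {T : Type}.
Local Open Scope ereal_scope.
Implicit Types (A : set T) (f : T -> R) (alpha b : \bar R).

(** The bound [b < +oo] matters because [+oo + -oo] is [-oo] in [\bar R]. *)
Lemma le_add_ereal_inf A f alpha b : A !=set0 -> b < +oo ->
    (forall x, A x -> alpha <= b + (f x)%:E) ->
  alpha <= b + ereal_inf [set (f x)%:E | x in A].
Proof.
move=> [x0 Ax0]; case: b => [b||] //= _ le_f; last first.
  by rewrite addNye; have := le_f _ Ax0; rewrite addNye.
rewrite -leeBlDl //; apply/ereal_infP => _ [x Ax <-].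
by rewrite leeBlDl // le_f.
Qed.

Lemma le_sub_ereal_sup A f alpha b : A !=set0 -> b < +oo ->
    (forall x, A x -> alpha <= b - (f x)%:E) ->
  alpha <= b - ereal_sup [set (f x)%:E | x in A].
Proof.
move=> A0 boo le_f; rewrite -ereal_infN image_comp.
exact: (@le_add_ereal_inf _ (fun x => - f x)%R).
Qed.

(** The infimum of a sum of functions of independent variables is the sum of
    their infima; the infima are taken one variable at a time, the remaining
    ones being kept in [b]. *)
Lemma le_add_sum_ereal_inf (k : nat) (A : nat -> set T) (f : nat -> T -> R)
    alpha b (y0 : nat -> T) :
    (forall t, (t < k)%N -> A t (y0 t)) -> b < +oo ->
    (forall y : nat -> T, (forall t, (t < k)%N -> A t (y t)) ->
       alpha <= b + (\sum_(0 <= t < k) f t (y t))%:E) ->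
  alpha <= b + \sum_(0 <= t < k) ereal_inf [set (f t x)%:E | x in A t].
Proof.
elim: k b => [|k IHk] b Ay0 boo le_f.
  by have := le_f y0 Ay0; rewrite !big_geq.
rewrite big_nat_recr //= addeCA addeC; apply: IHk => [t tk||y Ay].
- by apply: Ay0; rewrite ltnS ltnW.
- rewrite lte_add_pinfty // (le_lt_trans _ (ltry (f k (y0 k)))) //.
  by apply: ereal_inf_lbound; exists (y0 k) => //; exact: Ay0.
rewrite [leRHS]addeC addeA [X in X + _]addeC.
apply: le_add_ereal_inf => [||x Ax].
- by exists (y0 k); exact: Ay0.
- by rewrite lte_add_pinfty // ltry.
have := le_f (fun t => if t == k then x else y t).
rewrite big_nat_recr //= eqxx EFinD addeA.
under eq_big_nat => t /andP[_ tk] do rewrite (ltn_eqF tk).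
apply=> t; rewrite ltnS leq_eqVlt; case: eqP => [->//|_ /=]; exact: Ay.
Qed.

End extended_sums.

(** * Decoupled trajectories *)

Section decoupling.
Context {R : realType} {n : nat}.
Local Notation V := 'rV[R]_n.
Local Notation E := ((nat -> V * V * V) * (V * V) * (V * V))%type.
Variable M : nat.
Local Notation N := M.+2.
Implicit Types (e f : E) (x xs mus : nat -> V) (t : nat).

(** A decoupled choice is [e = (y, (q0, q1), p)]; the three functions below read
    off the copies of the state at time [t], for [t <= N] in the case of
    [first_copy] and [third_copy] and for [t < N] in the case of
    [second_copy]. *)
Definition first_copy e t : V :=
  if (t < N.-1)%N then (e.1.1 t).1.1 else if t == N.-1 then e.2.1 else e.2.2.

Definition second_copy e t : V :=
  if t is s.+1 then (e.1.1 s).1.2 else e.1.2.1.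

Definition third_copy e t : V :=
  match t with 0 => e.1.2.1 | 1 => e.1.2.2 | s.+2 => (e.1.1 s).2 end.

Definition split x : E :=
  (fun t => (x t, x t.+1, x t.+2), (x 0%N, x 1%N), (x N.-1, x N)).

Lemma first_copy_linear a e f t :
  first_copy (a *: e + f) t = a *: first_copy e t + first_copy f t.
Proof. by rewrite /first_copy; case: ifP => // _; case: ifP. Qed.

Lemma second_copy_linear a e f t :
  second_copy (a *: e + f) t = a *: second_copy e t + second_copy f t.
Proof. by case: t. Qed.

Lemma third_copy_linear a e f t :
  third_copy (a *: e + f) t = a *: third_copy e t + third_copy f t.
Proof. by case: t => [|[|t]]. Qed.

Lemma first_copy_split x t : (t <= N)%N -> first_copy (split x) t = x t.
Proof.
rewrite /first_copy => tN; case: ltnP => // t1; case: eqP => [->//|/eqP tN1].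
by congr x; lia.
Qed.

Lemma second_copy_split x t : second_copy (split x) t = x t.
Proof. by case: t. Qed.

Lemma third_copy_split x t : third_copy (split x) t = x t.
Proof. by case: t => [|[|t]]. Qed.

Definition gap_index := ('I_N.+1 * 'I_n + 'I_N * 'I_n)%type.

(** The coupling constraints, coordinate by coordinate. *)
Definition gap (i : gap_index) e : R :=
  match i with
  | inl (t, j) => (first_copy e t - third_copy e t) 0 j
  | inr (t, j) => (second_copy e t - first_copy e t) 0 j
  end.

Lemma gap_linear i a e f : gap i (a *: e + f) = a * gap i e + gap i f.
Proof.
case: i => -[t j] /=;
  rewrite !(first_copy_linear, second_copy_linear, third_copy_linear) !mxE;
  ring.
Qed.

Lemma gap_split i x : gap i (split x) = 0.
Proof.
case: i => -[t j] /=; rewrite (second_copy_split, third_copy_split).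
  by rewrite first_copy_split ?subrr ?mxE // -ltnS.
by rewrite first_copy_split ?subrr ?mxE // ltnW.
Qed.

Lemma gapZ i a e : gap i (a *: e) = a * gap i e.
Proof.
by rewrite -[a *: e]addr0 gap_linear (gap_split i 0 : gap i 0 = 0) addr0.
Qed.

Variables (F : nat -> V -> V -> set V) (Q0 Q1 : set V).
Variable phi : V * V -> \bar R.

Definition admissible e : Prop :=
  [/\ forall t, (t.+2 <= N)%N -> gph (F t) (e.1.1 t),
      Q0 e.1.2.1, Q1 e.1.2.2 & edom phi e.2].

Definition cost e : R := fine (phi e.2).

Lemma split_admissible x : feasible N F Q0 Q1 x ->
  edom phi (x N.-1, x N) -> admissible (split x).
Proof. by move=> [Fx Q0x Q1x] domx; split. Qed.

Lemma gap0_split e : (forall i, gap i e = 0) -> forall t, (t <= N)%N ->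
  third_copy e t = first_copy e t /\ 
  ((t < N)%N -> second_copy e t = first_copy e t).
Proof.
move=> e0 t tN; split=> [|tN1]; apply/rowP=> j.
- have := e0 (inl (Ordinal (tN : (t < N.+1)%N), j)).
  by rewrite /= !mxE => /eqP; rewrite subr_eq0 => /eqP.
- have := e0 (inr (Ordinal tN1, j)).
  by rewrite /= !mxE => /eqP; rewrite subr_eq0 => /eqP.
Qed.

Lemma gap0_feasible e : admissible e -> (forall i, gap i e = 0) ->
  feasible N F Q0 Q1 (first_copy e) /\
  (first_copy e N.-1, first_copy e N) = e.2.
Proof.
move=> [Fe Q0e Q1e _] /gap0_split e0; split; last first.
  rewrite /first_copy ltnn eqxx ltnNge leqnSn /= gtn_eqF //.
  by case: e.2.
split=> [t tN||].
- have := Fe t tN; rewrite /gph /=.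
  have [_ /(_ tN) <-] := e0 t.+1 (ltnW tN).
  have [<- _] := e0 t.+2 tN.
  by rewrite [first_copy e t]/first_copy ifT /=.
- by have [<-] := e0 0%N isT.
- by have [<-] := e0 1%N isT.
Qed.

(** * The Lagrangian and the dual objective *)

Definition block_term xs mus t (w : V * V * V) : R :=
  dot w.1.1 (xs t - mus t) + dot w.1.2 (mus t.+1) - dot w.2 (xs t.+2).

Definition lagrangian xs mus e : R :=
  cost e - dot2 e.2 (mus N.-1 - xs N.-1, - xs N)
  + \sum_(0 <= t < N.-1) block_term xs mus t (e.1.1 t)
  - dot e.1.2.1 (xs 0%N - mus 0%N) - dot e.1.2.2 (xs 1%N).

(** Summation by parts over the occurrences of each state: the first entry of
    block [t] carries [xs t - mus t], the middle one [mus t.+1] and the last one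
    [- xs t.+2]; the copies held by [p], [q0] and [q1] carry what is left at the
    two ends of the horizon. *)
Lemma lagrangianE xs mus e : lagrangian xs mus e = cost e
  + \sum_(0 <= t < N.+1) dot (first_copy e t - third_copy e t) (xs t)
  + \sum_(0 <= t < N) dot (second_copy e t - first_copy e t) (mus t).
Proof.
have first_sum (z : nat -> V) : \sum_(0 <= t < N) dot (first_copy e t) (z t) =
    \sum_(0 <= t < N.-1) dot (e.1.1 t).1.1 (z t) + dot e.2.1 (z N.-1).
  rewrite big_nat_recr //= {2}/first_copy ltnn eqxx; congr (_ + _).
  by apply: eq_big_nat => t /andP[_ tN]; rewrite /first_copy tN.
have first_sumN : \sum_(0 <= t < N.+1) dot (first_copy e t) (xs t) =
    \sum_(0 <= t < N.-1) dot (e.1.1 t).1.1 (xs t)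
    + dot e.2.1 (xs N.-1) + dot e.2.2 (xs N).
  rewrite big_nat_recr // first_sum; congr (_ + dot _ _).
  by rewrite /first_copy ltnNge leqnSn /= gtn_eqF.
have block_sum : \sum_(0 <= t < N.-1) block_term xs mus t (e.1.1 t) =
    \sum_(0 <= t < N.-1) dot (e.1.1 t).1.1 (xs t)
    - \sum_(0 <= t < N.-1) dot (e.1.1 t).1.1 (mus t)
    + \sum_(0 <= t < N.-1) dot (e.1.1 t).1.2 (mus t.+1)
    - \sum_(0 <= t < N.-1) dot (e.1.1 t).2 (xs t.+2).
  rewrite -!(sumrB, big_split) /=; apply: eq_bigr => t _.
  by rewrite /block_term dotBr.
have third_sum : \sum_(0 <= t < N.+1) dot (third_copy e t) (xs t) =
    dot e.1.2.1 (xs 0%N) + (dot e.1.2.2 (xs 1%N)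
    + \sum_(0 <= t < N.-1) dot (e.1.1 t).2 (xs t.+2)).
  by rewrite big_nat_recl // big_nat_recl.
have second_sum : \sum_(0 <= t < N) dot (second_copy e t) (mus t) =
    dot e.1.2.1 (mus 0%N) + \sum_(0 <= t < N.-1) dot (e.1.1 t).1.2 (mus t.+1).
  by rewrite big_nat_recl.
rewrite /lagrangian block_sum.
under [in RHS]eq_bigr do rewrite dotBl.
under [X in _ = _ + _ + X]eq_bigr do rewrite dotBl.
rewrite !sumrB third_sum second_sum first_sumN first_sum.
by rewrite /dot2 /= !dotBr dotNr; ring.
Qed.

Lemma lagrangian_split xs mus x : lagrangian xs mus (split x) = cost (split x).
Proof.
rewrite lagrangianE !big1_seq ?addr0 // => t /andP[_];
  rewrite mem_index_iota => /andP[_ tN].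
- by rewrite second_copy_split first_copy_split ?subrr ?dot0l // ltnW.
- by rewrite third_copy_split first_copy_split ?subrr ?dot0l.
Qed.

Lemma proper_finE p : proper_efun phi -> edom phi p ->
  phi p = (fine (phi p))%:E.
Proof. by move=> [phiNy _] dom; rewrite fineK // fin_real // ltNye phiNy. Qed.

(** Points where [phi] is infinite contribute [-oo] to the supremum. *)
Lemma conjugate_edom ps : proper_efun phi ->
  conjugate phi ps =
  ereal_sup [set (dot2 p ps - fine (phi p))%:E | p in edom phi].
Proof.
move=> phi_proper; apply/eqP; rewrite eq_le; apply/andP; split.
- apply/ereal_supP => _ [p _ <-].
  have [dom|/negP] := pselect (edom phi p); last first.
    by rewrite -leNgt leye_eq => /eqP ->; rewrite addeNy leNye.
  rewrite (proper_finE phi_proper dom) -EFinB.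
  by apply: ereal_sup_ubound; exists p.
- apply/ereal_supP => _ [p dom <-]; rewrite EFinB -proper_finE //.
  by apply: ereal_sup_ubound; exists p.
Qed.

Lemma dual_objective_le xs mus e : proper_efun phi -> admissible e ->
  (dual_objective N F Q0 Q1 phi xs mus <= (lagrangian xs mus e)%:E)%E.
Proof.
move=> phi_proper [Fe Q0e Q1e dome].
rewrite /dual_objective /lagrangian !EFinB EFinD -sumEFin.
apply: leeB; last by apply: ereal_sup_ubound; exists e.1.2.2.
apply: leeB; last by apply: ereal_sup_ubound; exists e.1.2.1.
apply: leeD.
  rewrite leeNl -EFinN opprB conjugate_edom //.
  by apply: ereal_sup_ubound; exists e.2.
rewrite big_seq [leRHS]big_seq; apply: lee_sum => t.
rewrite mem_index_iota => /andP[_ tN].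
by apply: ereal_inf_lbound; exists (e.1.1 t) => //; exact: Fe.
Qed.

(** The converse of [dual_objective_le]: the blocks of an admissible choice are
    independent of each other, so the infimum of the Lagrangian is the sum of
    the infima of its block terms.  The admissible point keeps all these infima
    below [+oo]. *)
Lemma dual_objective_ge xs mus a : proper_efun phi ->
    (exists e, admissible e) ->
  (a%:E <= dual_objective N F Q0 Q1 phi xs mus)%E <->
  forall e, admissible e -> a <= lagrangian xs mus e.
Proof.
move=> phi_proper [e0 [Fe0 Q0e0 Q1e0 dome0]]; split=> [le_dual e adm|le_lag].
- rewrite -lee_fin; apply: (le_trans le_dual).
  exact: dual_objective_le.
- rewrite /dual_objective conjugate_edom //.
  pose b t w := block_term xs mus t w.
  pose S :=
    (\sum_(0 <= t < N.-1) ereal_inf [set (b t w)%:E | w in gph (F t)])%E.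
  rewrite -[X in (_ + X - _ - _)%E]/S.
  have S_lty : (S < +oo)%E.
    rewrite /S big_seq; apply: lte_sum_pinfty => t.
    rewrite mem_index_iota => /andP[_ tN].
    apply: (le_lt_trans _ (ltry (b t (e0.1.1 t)))).
    by apply: ereal_inf_lbound; exists (e0.1.1 t) => //; exact: Fe0.
  have oppsup_lty (T : Type) (A : set T) (f : T -> R) z : A z ->
      (- ereal_sup [set (f x)%:E | x in A] < +oo)%E.
    move=> Az; rewrite lteNl; apply: (lt_le_trans (ltNyr (f z))).
    by apply: ereal_sup_ubound; exists z.
  have rotate (u v w z : \bar R) : (u + v + w + z = v + w + z + u)%E.
    by rewrite -!addeA addeC -!addeA.
  apply: le_sub_ereal_sup => [||q1 Q1q1]; first by exists e0.1.2.2.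
    rewrite !lte_add_pinfty //; first exact: oppsup_lty dome0.
    exact: oppsup_lty Q0e0.
  rewrite addeAC; apply: le_sub_ereal_sup => [||q0 Q0q0].
    by exists e0.1.2.1.
    rewrite !lte_add_pinfty // ?ltNyr //; first exact: oppsup_lty dome0.
    by rewrite -EFinN ltry.
  rewrite addeAC rotate; apply: le_sub_ereal_sup => [||p dom].
    by exists e0.2.
    by rewrite !lte_add_pinfty // -EFinN ltry.
  rewrite rotate -!EFinN -!EFinD.
  apply: (le_add_sum_ereal_inf (y0 := e0.1.1)) => [t tN||y Fy].
  - exact: Fe0.
  - exact: ltry.
  rewrite -EFinD lee_fin.
  have adm : admissible (y, (q0, q1), p) by [].
  by apply: (le_trans (le_lag _ adm)); rewrite /lagrangian /cost /=; lra.
Qed.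

Definition stationary xs mus e0 : Prop :=
  [/\ forall t, (t.+2 <= N)%N -> forall w, gph (F t) w ->
        block_term xs mus t (e0.1.1 t) <= block_term xs mus t w,
      (forall q, Q0 q ->
         dot q (xs 0%N - mus 0%N) <= dot e0.1.2.1 (xs 0%N - mus 0%N)),
      (forall q, Q1 q -> dot q (xs 1%N) <= dot e0.1.2.2 (xs 1%N)) &
      (forall p, edom phi p ->
         fine (phi e0.2) - dot2 e0.2 (mus N.-1 - xs N.-1, - xs N) <=
         fine (phi p) - dot2 p (mus N.-1 - xs N.-1, - xs N))].

(** Changing a single block of an admissible choice keeps it admissible, so a
    minimizer of the Lagrangian minimizes each block term. *)
Lemma lagrangian_minP xs mus e0 : admissible e0 ->
  (forall e, admissible e -> lagrangian xs mus e0 <= lagrangian xs mus e) <->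
  stationary xs mus e0.
Proof.
move=> [Fe0 Q0e0 Q1e0 dome0]; split=> [le_lag|[leF le0 le1 lephi]].
- split.
  + move=> t tN w Fw.
    have adm :
        admissible (fun s => if s == t then w else e0.1.1 s, e0.1.2, e0.2).
      by split=> // s sN /=; case: eqP => [->//|_]; exact: Fe0.
    have := le_lag _ adm; rewrite /lagrangian /= !lerD2r lerD2l.
    have mem_t : t \in index_iota 0 N.-1 by rewrite mem_index_iota.
    rewrite !(bigD1_seq t mem_t (iota_uniq _ _)) /= eqxx.
    under [X in _ <= _ + X]eq_bigr => s /negbTE st do rewrite st.
    by rewrite lerD2r.
  + move=> q Qq.
    have adm : admissible (e0.1.1, (q, e0.1.2.2), e0.2) by [].
    by have := le_lag _ adm; rewrite /lagrangian /=; lra.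
  + move=> q Qq.
    have adm : admissible (e0.1.1, (e0.1.2.1, q), e0.2) by [].
    by have := le_lag _ adm; rewrite /lagrangian /=; lra.
  + move=> p dom.
    have adm : admissible (e0.1.1, e0.1.2, p) by [].
    by have := le_lag _ adm; rewrite /lagrangian /cost /=; lra.
- move=> e [Fe Q0e Q1e dome]; rewrite /lagrangian.
  have := lephi _ dome; have := le0 _ Q0e; have := le1 _ Q1e.
  have : \sum_(0 <= t < N.-1) block_term xs mus t (e0.1.1 t) <=
         \sum_(0 <= t < N.-1) block_term xs mus t (e.1.1 t).
    by apply: ler_sum_nat => t /andP[_ tN]; apply: leF => //; exact: Fe.
  by rewrite /cost; lra.
Qed.

(** * Nondegeneracy and strong duality *)

Lemma epigraph_convex (p q : V * V) (l : R) : proper_efun phi ->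
    convex_closed (epigraph phi) -> edom phi p -> edom phi q ->
    0 < l < 1 ->
  edom phi (l *: p + (1 - l) *: q) /\
  fine (phi (l *: p + (1 - l) *: q)) <=
    l * fine (phi p) + (1 - l) * fine (phi q).
Proof.
move=> phi_proper [cphi _] domp domq l01.
have epi r : edom phi r -> epigraph phi (r, fine (phi r)).
  by move=> dom; rewrite /epigraph /= -proper_finE.
have := convex_comb cphi (epi _ domp) (epi _ domq) l01.
rewrite /epigraph /= => le_phi.
have dom : edom phi (l *: p + (1 - l) *: q).
  exact: le_lt_trans le_phi (ltry _).
by split=> //; rewrite -lee_fin -proper_finE.
Qed.

Lemma admissible_convex e f (l : R) : proper_efun phi ->
    (forall t, (t.+2 <= N)%N -> convex_closed (gph (F t))) ->
    convex_closed Q0 -> convex_closed Q1 -> convex_closed (epigraph phi) ->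
    admissible e -> admissible f -> 0 < l < 1 ->
  admissible (l *: e + (1 - l) *: f) /\
  cost (l *: e + (1 - l) *: f) <= l * cost e + (1 - l) * cost f.
Proof.
move=> phi_proper cF [cQ0 _] [cQ1 _] cphi.
move=> [Fe Q0e Q1e dome] [Ff Q0f Q1f domf] l01.
have [dom le_phi] := epigraph_convex phi_proper cphi dome domf l01.
split=> //; split=> //.
- move=> t tN; have [cFt _] := cF t tN.
  exact: (convex_comb cFt (Fe t tN) (Ff t tN) l01).
- exact: (convex_comb cQ0 Q0e Q0f l01).
- exact: (convex_comb cQ1 Q1e Q1f l01).
Qed.

(** The gaps of [split x0 + l *: (split d - e)] are [- l] times those of [e], as
    trajectories have no gaps, so this is the constraint qualification of
    [multipliers_seq].  The direction [d] is the freedom that absorbs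
    the exceptional time in the second form of the nondegeneracy condition. *)
Definition slater x0 : Prop := forall e, admissible e ->
  exists d, \forall l \near 0^'+, admissible (split x0 + l *: (split d - e)).

Lemma admissible_near x0 e :
  (forall t, (t.+2 <= N)%N -> \forall l \near 0^'+,
    gph (F t) ((split x0).1.1 t + l *: e.1.1 t)) ->
  (\forall l \near 0^'+, Q0 (x0 0%N + l *: e.1.2.1)) ->
  (\forall l \near 0^'+, Q1 (x0 1%N + l *: e.1.2.2)) ->
  (\forall l \near 0^'+, edom phi ((x0 N.-1, x0 N) + l *: e.2)) ->
  \forall l \near 0^'+, admissible (split x0 + l *: e).
Proof.
move=> nearF nearQ0 nearQ1 nearphi.
have nearF' : \forall l \near 0^'+, forall t : 'I_N.-1,
    gph (F t) ((split x0).1.1 t + l *: e.1.1 t).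
  by apply: filter_forall => -[t tN]; exact: nearF.
near=> l; split; last 3 first.
- by near: l.
- by near: l.
- by near: l.
move=> t tN; rewrite -[t]/(nat_of_ord (Ordinal (tN : (t < N.-1)%N))).
move: (Ordinal _); near: l; exact: nearF'.
Unshelve. all: by end_near. Qed.

Lemma nondegenerate_ri_slater x0 :
  nondegenerate_ri N F Q0 Q1 phi x0 -> slater x0.
Proof.
move=> [riF riQ0 riQ1 riphi] e [Fe Q0e Q1e dome]; exists x0.
apply: admissible_near => [t tN|||].
- exact: relint_ray (riF t tN) (Fe t tN).
- exact: relint_ray riQ0 Q0e.
- exact: relint_ray riQ1 Q1e.
- exact: relint_ray riphi dome.
Qed.

Lemma nondegenerate_int_slater x0 :
  nondegenerate_int N F Q0 Q1 phi x0 -> slater x0.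
Proof.
move=> [[s intF] intQ0 intQ1 [phi_fin cphi]] e [Fe Q0e Q1e dome].
(* The trajectory [d] follows block [s] of [e], so block [s] of [split x0] is
   not moved, and membership in the graph suffices there. *)
pose d t := if t == s then (e.1.1 s).1.1 else
            if t == s.+1 then (e.1.1 s).1.2 else (e.1.1 s).2.
have ds : (split d - e).1.1 s = 0.
  change ((d s, d s.+1, d s.+2) - e.1.1 s = 0).
  rewrite /d eqxx eqn_leq ltnn eqxx eqn_leq ltnNge leqnSn /=.
  rewrite eqn_leq ltnn /=.
  by case: (e.1.1 s) => -[? ?] ?; rewrite subrr.
exists d; apply: admissible_near => [t tN|||].
- have [Fx0 intFt] := intF t tN.
  have [ts|/intFt intFts] := eqVneq t s; last exact: interior_ray.
  by near=> l; rewrite ts ds scaler0 addr0 -ts.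
- exact: interior_ray.
- exact: interior_ray.
- apply: interior_ray; apply: (cphi [set y | (y < +oo)%E]).
  apply: open_nbhs_nbhs; split; first exact: open_ereal_lt_ereal.
  by rewrite /= ltey_eq phi_fin.
Unshelve. all: by end_near. Qed.

(** Only the times [t < N.+1] (resp. [t < N]) occur in [lagrangianE], and there
    [inord t] is the ordinal of value [t]. *)
Lemma gap_lagrangian (k : gap_index -> R) : exists xs mus, forall e,
  lagrangian xs mus e = cost e + \sum_i k i * gap i e.
Proof.
exists (fun t => \row_j k (inl (inord t, j))).
exists (fun t => \row_j k (inr (inord t, j))) => e.
rewrite lagrangianE !big_mkord big_sumType /= addrA.
congr (_ + _ + _).
- transitivity
    (\sum_(t < N.+1) \sum_(j < n) k (inl (t, j)) * gap (inl (t, j)) e).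
    apply: eq_bigr => t _; apply: eq_bigr => j _.
    by rewrite /= !mxE inord_val mulrC.
  by rewrite pair_bigA; apply: eq_bigr => -[].
- transitivity
    (\sum_(t < N) \sum_(j < n) k (inr (t, j)) * gap (inr (t, j)) e).
    apply: eq_bigr => t _; apply: eq_bigr => j _.
    by rewrite /= !mxE inord_val mulrC.
  by rewrite pair_bigA; apply: eq_bigr => -[].
Qed.

(** The decoupled problem has the same lower bounds as the primal one, because a
    choice without gaps is a trajectory ([gap0_feasible]); the multipliers then
    come from [multipliers_seq]. *)
Lemma strong_duality (alpha : R) x0 : proper_efun phi ->
    (forall t, (t.+2 <= N)%N -> convex_closed (gph (F t))) ->
    convex_closed Q0 -> convex_closed Q1 -> convex_closed (epigraph phi) ->
    slater x0 ->
    (forall x, feasible N F Q0 Q1 x ->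
      (alpha%:E <= primal_objective N phi x)%E) ->
  exists xs mus, forall e, admissible e -> alpha <= lagrangian xs mus e.
Proof.
move=> phi_proper cF cQ0 cQ1 cphi sl opt.
have [|a b l Sa Sb l01|e Se|e Se e0|k kP] := @multipliers_seq R _ gap_index
    (index_enum gap_index) gap admissible cost alpha.
- exact: index_enum_uniq.
- have [Sc le_c] := admissible_convex phi_proper cF cQ0 cQ1 cphi Sa Sb l01.
  exists (l *: a + (1 - l) *: b); split=> // i.
  by rewrite gap_linear gapZ.
- have [d near_d] := sl _ Se.
  have [l [l0 Sl]] : exists l : R,
      0 < l /\ admissible (split x0 + l *: (split d - e)).
    apply: (@filter_ex _ 0^'+); near=> l; split; near: l; last exact: near_d.
    exact: nbhs_right_gt.
  exists (split x0 + l *: (split d - e)); exists l => //; split=> // i.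
  rewrite addrC gap_linear addrC -scaleN1r [split d + _]addrC gap_linear.
  by rewrite !gap_split; ring.
- have [feas term] : feasible N F Q0 Q1 (first_copy e) /\
      (first_copy e N.-1, first_copy e N) = e.2.
    by apply: gap0_feasible => // i; apply: e0; rewrite mem_index_enum.
  have := opt _ feas; rewrite /primal_objective term.
  by rewrite proper_finE ?lee_fin //; case: Se.
have [xs [mus lagP]] := gap_lagrangian k.
by exists xs, mus => e Se; rewrite lagP; exact: kP.
Unshelve. all: by end_near. Qed.

(** * Stationarity of the Lagrangian and optimality *)

Lemma subdifferential_finE p0 ps : proper_efun phi -> edom phi p0 ->
  subdifferential phi p0 ps <->
  forall p, edom phi p ->
    fine (phi p0) - dot2 p0 ps <= fine (phi p) - dot2 p ps.
Proof.
move=> phi_proper dom0; split=> H p.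
  move=> domp; have := H p.
  rewrite (proper_finE phi_proper dom0) (proper_finE phi_proper domp).
  by rewrite -EFinD lee_fin dot2Bl; lra.
have [domp|/negP] := pselect (edom phi p); last first.
  by rewrite -leNgt leye_eq => /eqP ->; rewrite leey.
rewrite (proper_finE phi_proper dom0) (proper_finE phi_proper domp).
by rewrite -EFinD lee_fin dot2Bl; have := H p domp; lra.
Qed.

Lemma locally_adjointE xs mus t w0 :
    convex_closed (gph (F t)) -> gph (F t) w0 ->
  locally_adjoint (F t) (xs t.+2) w0 (xs t - mus t, mus t.+1) <->
  forall w, gph (F t) w -> block_term xs mus t w0 <= block_term xs mus t w.
Proof.
move=> [cF _] Fw0; rewrite /locally_adjoint /= dual_tangent_coneE //.
- by rewrite /block_term /dot3 /dot2 /=; split=> H w /H; rewrite !dotNr.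
- exact: dot3_linear.
- exact: dot3_continuous.
Qed.

Lemma dual_tangent_cone_dotE (A : set V) (q0 qs : V) :
    convex_closed A -> A q0 ->
  dual_tangent_cone dot A q0 qs <-> forall q, A q -> dot q0 qs <= dot q qs.
Proof.
move=> [cA _] Aq0; rewrite dual_tangent_coneE //.
- exact: dot_linear.
- exact: dot_continuous.
Qed.

Lemma stationaryP xs mus x : proper_efun phi ->
    (forall t, (t.+2 <= N)%N -> convex_closed (gph (F t))) ->
    convex_closed Q0 -> convex_closed Q1 ->
    feasible N F Q0 Q1 x -> edom phi (x N.-1, x N) ->
  stationary xs mus (split x) <->
  [/\ forall t, (t.+2 <= N)%N ->
        locally_adjoint (F t) (xs t.+2) (x t, x t.+1, x t.+2)
          (xs t - mus t, mus t.+1),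
      dual_tangent_cone dot Q0 (x 0%N) (mus 0%N - xs 0%N) /\
      dual_tangent_cone dot Q1 (x 1%N) (- xs 1%N) &
      subdifferential phi (x N.-1, x N) (mus N.-1 - xs N.-1, - xs N)].
Proof.
move=> phi_proper cF cQ0 cQ1 [Fx Q0x Q1x] dom.
have adjoint t (tN : (t.+2 <= N)%N) :=
  locally_adjointE xs mus (w0 := (x t, x t.+1, x t.+2)) (cF t tN) (Fx t tN).
have cone0 := dual_tangent_cone_dotE (mus 0%N - xs 0%N) cQ0 Q0x.
have cone1 := dual_tangent_cone_dotE (- xs 1%N) cQ1 Q1x.
have sub := subdifferential_finE (mus N.-1 - xs N.-1, - xs N) phi_proper dom.
split=> [[HF H0 H1 /sub Hphi]|[HF [/cone0 H0 /cone1 H1] /sub Hphi]].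
- split=> //; first by move=> t tN; apply/adjoint => //; exact: HF.
  split; [apply/cone0 => q Qq | apply/cone1 => q Qq].
  + by have := H0 _ Qq; rewrite !dotBr; lra.
  + by rewrite !dotNr lerN2; exact: H1.
- split=> // [t tN|q Qq|q Qq].
  + by apply/adjoint => //; exact: HF.
  + by have := H0 _ Qq; rewrite !dotBr; lra.
  + by have := H1 _ Qq; rewrite !dotNr lerN2.
Qed.

End decoupling.

Theorem theorem3p3 (R : realType) (n N : nat) (N_ge2 : (2 <= N)%N)
    (F : nat -> 'rV[R]_n -> 'rV[R]_n -> set 'rV[R]_n)
    (Q0 Q1 : set 'rV[R]_n)
    (phi : 'rV[R]_n * 'rV[R]_n -> \bar R)
    (F_cc : forall t : nat, (t.+2 <= N)%N -> convex_closed (gph (F t)))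
    (Q0_neq0 : Q0 !=set0) (Q0_cc : convex_closed Q0)
    (Q1_neq0 : Q1 !=set0) (Q1_cc : convex_closed Q1)
    (phi_proper : proper_efun phi) (phi_cc : convex_closed (epigraph phi))
    (xt : nat -> 'rV[R]_n)
    (xt_opt : primal_optimal N F Q0 Q1 phi xt)
    (nondeg : nondegeneracy N F Q0 Q1 phi) :
  forall xs mus : nat -> 'rV[R]_n,
    dual_optimal N F Q0 Q1 phi xs mus <->
    [/\ forall t : nat, (t.+2 <= N)%N ->
          locally_adjoint (F t) (xs t.+2) (xt t, xt t.+1, xt t.+2)
            (xs t - mus t, mus t.+1),
        dual_tangent_cone dot Q0 (xt 0%N) (mus 0%N - xs 0%N) /\
        dual_tangent_cone dot Q1 (xt 1%N) (- xs 1%N) &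
        subdifferential phi (xt N.-1, xt N)
          (mus N.-1 - xs N.-1, - xs N)].
Proof.
case: N N_ge2 F_cc xt_opt nondeg => [|[|M]] // _ F_cc.
move=> [xt_feas xt_min] nondeg xs mus.
have [x0 [x0_feas x0_dom x0_slater]] : exists x0,
    [/\ feasible M.+2 F Q0 Q1 x0, edom phi (x0 M.+1, x0 M.+2) &
        slater M F Q0 Q1 phi x0].
  case: nondeg => x0 [nd|nd]; exists x0; split.
  - by case: nd => [rF [Q0x _] [Q1x _] _]; split=> // t tN; case: (rF t tN).
  - by case: nd => [_ _ _ []].
  - exact: nondegenerate_ri_slater.
  - case: nd => [[s intF] /interior_subset Q0x /interior_subset Q1x _].
    by split=> // t tN; case: (intF t tN).
  - by case: nd => [_ _ _ [phi_fin _]]; rewrite /edom /= ltey_eq phi_fin.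
  - exact: nondegenerate_int_slater.
have xt_dom : edom phi (xt M.+1, xt M.+2).
  exact: le_lt_trans (xt_min _ x0_feas) x0_dom.
have xt_adm := split_admissible xt_feas xt_dom.
pose alpha := cost phi (split M xt).
have ge_alpha xs' mus' := dual_objective_ge xs' mus' alpha phi_proper
  (ex_intro _ _ xt_adm).
(* The Lagrangian of the optimal trajectory is its cost, for all multipliers. *)
have weak xs' mus' : (dual_objective M.+2 F Q0 Q1 phi xs' mus' <= alpha%:E)%E.
  have := dual_objective_le xs' mus' phi_proper xt_adm.
  by rewrite lagrangian_split.
have [xs0 [mus0 strong]] : exists xs' mus', forall e,
    admissible M F Q0 Q1 phi e -> alpha <= lagrangian M phi xs' mus' e.
  apply: strong_duality x0_slater _ => // x /xt_min.
  by rewrite /primal_objective (proper_finE phi_proper xt_dom).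
have value : dual_value M.+2 F Q0 Q1 phi = alpha%:E.
  apply/eqP; rewrite eq_le; apply/andP; split.
    by apply/ereal_supP => _ [xs' [mus' ->]].
  have /ge_alpha := strong; move/le_trans; apply.
  by apply: ereal_sup_ubound; exists xs0, mus0.
rewrite -(stationaryP _ _ phi_proper F_cc Q0_cc Q1_cc xt_feas xt_dom).
rewrite /dual_optimal value -(lagrangian_minP xs mus xt_adm) lagrangian_split.
rewrite -ge_alpha; split=> [->//|le_dual].
by apply/eqP; rewrite eq_le weak.
Qed.
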